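(* For all (not necessarily totally) unimodular polytopes $P$, we have $E_P(k)^2 \geq E_P(k-1) \cdot E_P(k+1)$ for all $k \in \mathbb{Z}_{\geq 1}$.
   Context: An integer matrix $M$ is unimodular if all of its non-singular $\operatorname{rank}(M)\times\operatorname{rank}(M)$ submatrices have determinant $\pm1$. A unimodular polytope is a (bounded) polytope of the form $P=\{\bm{y}\in\mathbb{R}^n_{\ge 0}: M\bm{y}=\bm{b}\}$ where $M\in\mathbb{Z}^{m\times n}$ is a unimodular matrix and $\bm{b}\in\mathbb{Z}^m$; such a polytope has integral vertices. For a lattice polytope $P\subset\mathbb{R}^n$, the Ehrhart polynomial $E_P(t)$ is the unique polynomial such that $E_P(k)=\#(kP\cap\mathbb{Z}^n)$ for all $k\in\mathbb{Z}_{\ge0}$. *)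

(* Defs.v *)
From mathcomp Require Import all_boot all_order all_algebra finmap.
From mathcomp Require Import all_classical all_reals all_analysis.

Set Implicit Arguments.
Unset Strict Implicit.
Unset Printing Implicit Defensive.

Import Order.TTheory GRing.Theory Num.Theory numFieldNormedType.Exports.

Local Open Scope classical_set_scope.
Local Open Scope ring_scope.

Definition int_rank m n (M : 'M[int]_(m, n)) : nat :=
  \rank (map_mx intr M : 'M[rat]_(m, n)).

(* A submatrix is given by the strictly increasing enumerations [f] and [g] of
   the selected rows and columns. *)
Definition unimodular m n (M : 'M[int]_(m, n)) : Prop :=
  forall (f : 'I_(int_rank M) -> 'I_m) (g : 'I_(int_rank M) -> 'I_n),
    {homo f : i j / (i < j)%N} -> {homo g : i j / (i < j)%N} ->
    \det (mxsub f g M) != 0 ->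
    \det (mxsub f g M) = 1 \/ \det (mxsub f g M) = -1.

Definition standard_polyhedron (R : realType) m n
    (M : 'M[int]_(m, n)) (b : 'cV[int]_m) : set 'cV[R]_n :=
  [set y : 'cV[R]_n | (forall i, 0 <= y i 0) /\
                      map_mx intr M *m y = map_mx intr b].

Definition unimodular_polytope (R : realType) n (P : set 'cV[R]_n) : Prop :=
  bounded_set P /\
  exists (m : nat) (M : 'M[int]_(m, n)) (b : 'cV[int]_m),
    unimodular M /\ P = standard_polyhedron M b.

Definition dilate (R : realType) n (k : nat) (P : set 'cV[R]_n)
    : set 'cV[R]_n :=
  [set k%:R *: y | y in P].

Definition integer_lattice (R : realType) n : set 'cV[R]_n :=
  [set y : 'cV[R]_n | forall i, y i 0 \is a Num.int].

(* [fset_set] returns the empty set on infinite sets; this does not happen for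
   bounded [P], whose dilates contain finitely many lattice points. *)
Definition lattice_count (R : realType) n (P : set 'cV[R]_n) : nat :=
  #|` fset_set (P `&` @integer_lattice R n)|.

Definition is_ehrhart_poly (R : realType) n (P : set 'cV[R]_n)
    (E : {poly R}) : Prop :=
  forall k : nat, E.[k%:R] = (lattice_count (dilate k P))%:R.

Lemma is_ehrhart_poly_inj (R : realType) n (P : set 'cV[R]_n)
    (E F : {poly R}) :
  is_ehrhart_poly P E -> is_ehrhart_poly P F -> E = F.
Proof.
move=> hE hF; apply/eqP; rewrite -subr_eq0; apply/negPn/negP => nz.
have := @max_poly_roots _ (E - F)
  [seq k%:R | k <- iota 0 (size (E - F))] nz.
rewrite size_map size_iota ltnn => H; suff: false by []; apply: H.
  by apply/allP => _ /mapP[k _ ->]; rewrite rootE !hornerE hE hF subrr.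
by rewrite map_inj_uniq ?iota_uniq// => i j /eqP; rewrite eqr_nat => /eqP.
Qed.

(* The polynomial exists, by Ehrhart's theorem, whenever [P] is a lattice
   polytope, and it is then characterised by [is_ehrhart_poly]; the default
   value 0 only makes the function total. *)
Definition ehrhart_poly (R : realType) n (P : set 'cV[R]_n) : {poly R} :=
  xget 0 [set E | is_ehrhart_poly P E].

Lemma ehrhart_polyE (R : realType) n (P : set 'cV[R]_n) (E : {poly R}) :
  is_ehrhart_poly P E -> ehrhart_poly P = E.
Proof.
by move=> hE; apply: xget_unique => // F hF; apply: is_ehrhart_poly_inj hF hE.
Qed.

(* Main.v *)
(* Let [L j] be the set of lattice points of the [j]-th dilate, that is, of the
   nonnegative integer solutions of [M y = j b]. Grouping the pairs in
   [L (k - 1) x L (k + 1)] and in [L k x L k] by their sum [w] reduces the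
   inequality to the following claim: if [M w = 2 c], then among all right-hand
   sides [c'] the number [N w c'] of integer solutions of [M y = c'] in the box
   [0 <= y <= w] is maximal at [c' = c].

   The claim is proved by induction on [w]. Grouping pairs of solutions by their
   difference [d] in [ker M] expresses [(N w c')^2] as the sum over [d] of
   [N (w - |d|) (c' - M d^-)], and the data [w - |d|], [c - M d^-] satisfy the
   same hypothesis as [w], [c]. The terms with [d <> 0] are compared by
   induction, and [d = 0] contributes [N w c'] itself, so
   [(N w c')^2 - N w c' <= (N w c)^2 - N w c]. Unimodularity enters only to give
   [N w c >= 1]: the box slice contains the rational point [w / 2], hence an
   integer point. *)

Require Import Defs.
From mathcomp Require Import all_boot all_order all_algebra.
From mathcomp Require Import all_classical all_reals all_analysis.
From mathcomp Require Import zify lra.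

Set Implicit Arguments.
Unset Strict Implicit.
Unset Printing Implicit Defensive.

Import Order.TTheory GRing.Theory Num.Theory numFieldNormedType.Exports.
Local Open Scope classical_set_scope.
Local Open Scope ring_scope.

(** * Unimodular systems: integral basic solutions and rounding in a box *)

Lemma enum_val_homo_ltn n (J : {set 'I_n}) :
  {homo (@enum_val _ (mem J)) : i j / (i < j)%N}.
Proof.
move=> i j ij; have x0 := enum_val i.
rewrite (enum_val_nth x0 i) (enum_val_nth x0 j).
have sJ : sorted ltn (map val (enum J)).
  apply: (@subseq_sorted _ ltn ltn_trans _ (map val (enum 'I_n))).
    by apply: map_subseq; rewrite !enumT; exact: filter_subseq.
  by rewrite val_enum_ord; exact: iota_ltn_sorted.
have lt_size (l : 'I_#|J|) : (l < size (enum J))%N by rewrite -cardE.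
have := sorted_ltn_nth ltn_trans (val x0) sJ i j.
by rewrite !inE size_map !(nth_map x0) // => ->.
Qed.

Lemma mul_rowsub_supp (F : pzRingType) m n p (A : 'M[F]_(p, m)) (B : 'M[F]_(m, n))
    r (f : 'I_r -> 'I_m) : injective f ->
  (forall i j, j \notin codom f -> A i j = 0) ->
  A *m B = colsub f A *m rowsub f B.
Proof.
move=> finj A0; apply/matrixP => i j; rewrite !mxE.
rewrite (bigID (mem (codom f))) /= [X in _ + X]big1 ?addr0; last first.
  by move=> k kf; rewrite A0 // mul0r.
have fu : uniq (codom f) by rewrite map_inj_uniq ?enum_uniq.
rewrite -(big_uniq (codom f)) //= big_image /=.
by apply: eq_bigr => k _; rewrite !mxE.
Qed.

(** Phrased through vectors supported on [T], so that a failure directly yields a kernel vector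
    supported there. *)
Definition rows_indep (F : fieldType) m n (A : 'M[F]_(m, n)) (T : {set 'I_m}) :=
  forall v : 'rV[F]_m, (forall i, i \notin T -> v 0 i = 0) ->
    v *m A = 0 -> v = 0.

Lemma rows_indep0 (F : fieldType) m n (A : 'M[F]_(m, n)) :
  rows_indep A finset.set0.
Proof. by move=> v v0 _; apply/rowP => i; rewrite mxE v0 ?finset.in_set0. Qed.

(** Enlarge [T] to a maximal independent set: by maximality its rows span the row space, so its size
    is the rank. Its increasing enumeration has the form required by [unimodular]. *)
Lemma rows_indep_basis (F : fieldType) m n (A : 'M[F]_(m, n)) (T : {set 'I_m})
    r : r = \rank A -> rows_indep A T ->
  exists f : 'I_r -> 'I_m, [/\ {homo f : i j / (i < j)%N},
    row_free (rowsub f A) & {subset T <= codom f}].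
Proof.
move=> rE indT.
have [J /maxsetP [/asboolP indJ Jmax] TJ] :=
  @maxset_exists _ (fun J => `[< rows_indep A J >]) T (introT (asboolP _) indT).
have [f [fhom finj fJ]] : exists f : 'I_#|J| -> 'I_m,
    [/\ {homo f : i j / (i < j)%N}, injective f &
      forall i, (i \in codom f) = (i \in J)].
  exists (@enum_val _ (mem J)); split=> [||i].
  - exact: enum_val_homo_ltn.
  - exact: enum_val_inj.
  - apply/codomP/idP => [[j ->]|iJ]; first exact: enum_valP.
    by exists (enum_rank_in iJ i); rewrite enum_rankK_in.
have freeJ : row_free (rowsub f A).
  apply: inj_row_free => v vA0.
  pose u : 'rV_m := v *m rowsub f 1%:M.
  have uf : colsub f u = v.
    apply/rowP => j; rewrite !mxE (bigD1 j) //= !mxE eqxx mulr1 big1 ?addr0 //.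
    by move=> k kj; rewrite !mxE (inj_eq finj) (negPf kj) mulr0.
  have u0 : u = 0.
    apply: indJ => [i iJ|].
      rewrite !mxE big1 // => k _; rewrite !mxE.
      case: eqP => [fki|_]; last by rewrite mulr0.
      by rewrite -fki -fJ codom_f in iJ.
    by rewrite /u -mulmxA -rowsubE.
  by rewrite -uf u0; apply/rowP => j; rewrite !mxE.
have AJ : (A <= rowsub f A)%MS.
  apply/row_subP => i; case: (boolP (i \in J)) => iJ.
    by move: (iJ); rewrite -fJ => /codomP[j ->]; rewrite -row_rowsub row_sub.
  have : ~ rows_indep A (i |: J)%SET.
    move=> /asboolP ind; have := Jmax _ ind (finset.subsetUr _ _).
    by move=> E; rewrite -E finset.setU11 in iJ.
  move=> /existsNP[v] /not_implyP[v0] /not_implyP[vA0 vn0].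
  have vi : v 0 i != 0.
    apply/eqP => vi; apply: vn0; apply: indJ => // j jJ.
    case: (eqVneq j i) => [-> //|ji]; apply: v0.
    by rewrite finset.in_setU1 negb_or ji.
  pose u := v - v 0 i *: delta_mx 0 i.
  have uA : u *m A = - v 0 i *: row i A.
    by rewrite mulmxBl vA0 sub0r -scalemxAl -rowE scaleNr.
  have -> : row i A = - (v 0 i)^-1 *: (u *m A).
    by rewrite uA scalerA mulrNN mulVf // scale1r.
  rewrite scalemx_sub // (mul_rowsub_supp A finj) ?submxMl // => a j.
  rewrite ord1 fJ => jJ; rewrite !mxE eqxx /=.
  case: (eqVneq j i) => [->|ji] /=; first by rewrite mulr1 subrr.
  by rewrite v0 ?mulr0 ?subr0 // finset.in_setU1 negb_or ji.
have rJ : #|J| = r.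
  apply/eqP; rewrite rE eqn_leq -{1}(eqP freeJ) mxrankS /=; last first.
    by rewrite rowsubE submxMl.
  by rewrite (leq_trans (mxrankS AJ)) // rank_leq_row.
move: f fhom finj fJ freeJ {AJ}; case: _ / rJ => f fhom finj fJ freeJ.
by exists f; split=> // i iT; rewrite fJ (fintype.subsetP TJ).
Qed.

(** Basic solutions are integral: the columns in [T] extend to a column basis, suitable rows cut out
    a non-singular square submatrix of it, and determinant 1 or -1 makes the inverse integral. *)
Lemma unimodular_int_sol m n (M : 'M[int]_(m, n)) (T : {set 'I_n})
    (d : 'cV[rat]_n) (c : 'cV[int]_m) :
  unimodular M -> rows_indep (map_mx intr M : 'M[rat]_(m, n))^T T ->
  (forall j, j \notin T -> d j 0 = 0) ->
  map_mx intr M *m d = map_mx intr c -> forall j, d j 0 \is a Num.int.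
Proof.
move=> uM indT dT Md.
have rE : int_rank M = \rank (map_mx intr M : 'M[rat]_(m, n))^T.
  by rewrite mxrank_tr.
have [f [fhom ffree Tf]] := rows_indep_basis rE indT.
have r2 : int_rank M = \rank (rowsub f (map_mx intr M : 'M[rat]_(m, n))^T)^T.
  by rewrite mxrank_tr (eqP ffree).
have [g [ghom gfree _]] := rows_indep_basis r2 (@rows_indep0 _ _ _ _).
set B := rowsub g _ in gfree.
have BE : B = map_mx intr (mxsub g f M) by apply/matrixP => i j; rewrite !mxE.
have finj : injective f.
  move=> i j fij; apply/val_inj/eqP; case: ltngtP => // /fhom;
  by rewrite fij ltnn.
have detB : \det (mxsub g f M) \is a GRing.unit.
  have : \det B != 0 by rewrite -unitfE -unitmxE -row_free_unit.
  rewrite BE det_map_mx intr_eq0 => /(uM _ _ ghom fhom).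
  by case=> ->; rewrite ?unitrN unitr1.
have Bd : B *m rowsub f d = map_mx intr (rowsub g c).
  rewrite map_mxsub -Md BE.
  have dsupp j : j \notin codom f -> d j 0 = 0.
    by move=> jf; apply: dT; apply: contraNN jf => /Tf.
  have dT0 : forall i j, j \notin codom f -> d^T i j = 0.
    by move=> i j jf; rewrite mxE ord1 dsupp.
  have := mul_rowsub_supp (map_mx intr M)^T finj dT0.
  rewrite -trmx_mul => /(congr1 trmx); rewrite trmxK trmx_mul => ->.
  rewrite !trmx_mxsub !trmxK -mul_rowsub_mx; congr (_ *m _).
  by apply/matrixP => i j; rewrite !mxE.
have dE : rowsub f d = map_mx intr (invmx (mxsub g f M) *m rowsub g c).
  have BU : B \in unitmx by rewrite -row_free_unit.
  apply: (can_inj (mulKmx BU)); rewrite Bd BE -map_mxM mulKVmx //.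
move=> j; case: (boolP (j \in codom f)) => [/codomP[l ->]|jf].
  by have /matrixP/(_ l 0) := dE; rewrite !mxE => ->; exact: intr_int.
by rewrite dT ?int_num0 //; apply: contraNN jf => /Tf.
Qed.

(** Induction on the number of fractional coordinates. While the columns of [M] there are dependent,
    a kernel vector supported on them moves [u] until one more coordinate is integral; once they are
    independent, [u] is integral. *)
Lemma unimodular_box_round m n (M : 'M[int]_(m, n)) (b : 'cV[int]_m)
    (w : 'cV[int]_n) (u : 'cV[rat]_n) :
  unimodular M -> (forall j, 0 <= u j 0 <= (w j 0)%:~R) ->
  map_mx intr M *m u = map_mx intr b ->
  exists2 z : 'cV[int]_n, forall j, 0 <= z j 0 <= w j 0 & M *m z = b.
Proof.
move=> uM; have [N] := ubnP #|[set j | u j 0 \isn't a Num.int]%SET|.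
elim: N u => // N IH u; set T := [set j | _]%SET => cardT u_box Mu.
have [indT|] := pselect (rows_indep (map_mx intr M : 'M[rat]_(m, n))^T T).
  pose z := map_mx Num.floor u.
  have uz j : u j 0 = (z j 0)%:~R.
    (* The fractional part of [u] is supported on [T] and has integral image under [M]. *)
    suff : (u - map_mx intr z) j 0 \is a Num.int.
      rewrite !mxE => ?; apply/esym/eqP; rewrite -intrEfloor.
      by rewrite -[u j 0](subrK (Num.floor (u j 0))%:~R) rpredD ?intr_int.
    apply: (unimodular_int_sol (T := T) (c := b - M *m z) uM indT).
      move=> i; rewrite finset.inE negbK intrEfloor => /eqP E.
      by rewrite !mxE E subrr.
    by rewrite mulmxBr Mu map_mxB map_mxM.
  exists z => [j|].
    by have := u_box j; rewrite uz ler0z ler_int.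
  suff /matrixP E : map_mx intr (M *m z) = map_mx intr b :> 'cV[rat]_m.
    by apply/matrixP => i j; have := E i j; rewrite 2![map_mx _ _ _ _]mxE => /intr_inj.
  rewrite map_mxM -Mu; congr (_ *m _); apply/colP => j.
  by rewrite uz !mxE.
move=> /existsNP[v] /not_implyP[vT] /not_implyP[vM vn0].
have [j0 vj0] : exists j, v 0 j != 0.
  by apply/rV0Pn; apply/eqP.
pose fl j : rat := (Num.floor (u j 0))%:~R.
have flP j : fl j <= u j 0 < fl j + 1.
  by rewrite /fl floor_le /= -[1]/(1%:~R) -intrD floorD1_gt.
(* Along [v], a coordinate [j] with [v 0 j != 0] reaches the end [e j] of its unit interval at time
   [t j]; stopping at the least such time keeps every coordinate in its interval. *)
pose e j := if 0 < v 0 j then fl j + 1 else fl j.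
pose t j := (e j - u j 0) / v 0 j.
case: (@arg_minP _ _ _ j0 (fun j => v 0 j != 0) t vj0) => j1 vj1 tmin.
pose u' := u + t j1 *: v^T.
have vT' j : v 0 j != 0 -> j \in T by apply: contraNT => /vT ->.
have u'E j : u' j 0 = u j 0 + t j1 * v 0 j by rewrite !mxE.
have t0 : 0 <= t j1.
  rewrite /t /e; have /andP[l1 l2] := flP j1.
  case: ltrgt0P vj1 => // vj _; first by rewrite divr_ge0 // ?ltW //; lra.
  by rewrite -mulrNN -invrN divr_ge0 //; lra.
have u'fl j : fl j <= u' j 0 <= fl j + 1.
  have /andP[l1 l2] := flP j; rewrite u'E.
  case: (ltrgt0P (v 0 j)) => vj; last by rewrite vj mulr0 addr0; lra.
    have := tmin j; rewrite gt_eqF // => /(_ isT).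
    rewrite {2}/t /e vj ler_pdivlMr // => ?.
    by have := mulr_ge0 t0 (ltW vj); lra.
  have := tmin j; rewrite lt_eqF // => /(_ isT).
  rewrite {2}/t /e ltNge (ltW vj) /= ler_ndivlMr // => ?.
  by have := mulr_ge0_le0 t0 (ltW vj); lra.
have u'j1 : u' j1 0 \is a Num.int.
  rewrite u'E /t divfK // addrC subrK /e /fl.
  by case: ifP => _; rewrite ?rpredD ?intr_int.
apply: (IH u').
- move: cardT; rewrite ltnS; apply: leq_trans; apply: proper_card.
  apply/properP; split.
    apply/fintype.subsetP => j; rewrite !finset.inE; apply: contraNN => uj.
    rewrite u'E; case: (eqVneq (v 0 j) 0) => [->|/vT'].
      by rewrite mulr0 addr0.
    by rewrite finset.inE uj.
  by exists j1; [exact: vT'|rewrite finset.inE u'j1].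
- move=> j; case: (boolP (j \in T)) => [jT|/vT vj]; last first.
    by rewrite u'E vj mulr0 addr0.
  have /andP[l1 l2] := u'fl j; have /andP[u0 uw] := u_box j.
  rewrite (le_trans _ l1) ?ler0z ?floor_ge0 //= (le_trans l2) //.
  (* A fractional [u j 0] is strictly below the integer [w j 0], so the upper end of its unit
     interval is at most [w j 0]. *)
  rewrite /fl -[1]/(1%:~R) -intrD ler_int lezD1 floor_lt_int lt_neqAle uw.
  rewrite andbT; move: jT; rewrite finset.inE; apply: contraNN => /eqP ->.
  exact: intr_int.
- rewrite mulmxDr Mu -scalemxAr.
  have -> : map_mx intr M *m v^T = 0.
    by rewrite -[map_mx intr M]trmxK -trmx_mul vM trmx0.
  by rewrite scaler0 addr0.
Qed.

(** * Counting pairs by their sum or difference *)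

(** A pair with sum [d] is determined by its second entry [y], as [(d - y, y)]. *)
Lemma size_mul_by_sum (V : zmodType) (s1 s2 D : seq V) : uniq s1 -> uniq D ->
  {in s1 & s2, forall x y, x + y \in D} ->
  (size s1 * size s2)%N = (\sum_(d <- D) count (fun y => (d - y)%R \in s1) s2)%N.
Proof.
move=> s1u Du sD.
under eq_bigr do rewrite -sum1_count big_mkcond.
rewrite exchange_big /= mulnC -sum1_size big_distrl /= !big_seq.
apply: eq_bigr => y ys2; rewrite mul1n -big_mkcond sum1_count -size_filter.
rewrite -(size_map (fun x => x + y)).
apply/perm_size/uniq_perm; rewrite ?filter_uniq ?map_inj_uniq //.
  exact: addIr.
move=> d; rewrite mem_filter; apply/mapP/andP => [[x xs1 ->]|[ds1 _]].
  by rewrite addrK xs1 sD.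
by exists (d - y); rewrite ?subrK.
Qed.

Lemma size_sqr_by_diff (V : zmodType) (s D : seq V) : uniq s -> uniq D ->
  {in s &, forall x y, x - y \in D} ->
  (size s ^ 2)%N = (\sum_(d <- D) count (fun y => (d + y)%R \in s) s)%N.
Proof.
move=> su Du sD; rewrite -mulnn -{2}(size_map -%R s).
rewrite (size_mul_by_sum su Du) => [|x _ xs /mapP[y ys ->]]; last exact: sD.
by apply: eq_bigr => d _; rewrite count_map; apply: eq_count => y /=; rewrite opprK.
Qed.

(* The zero difference contributes [size s] to the count of pairs of elements
   of [s], and [x ^ 2 - x] is increasing on positive integers. *)
Lemma leq_size_by_diff (V : zmodType) (A B : seq V) : uniq A -> uniq B ->
  (0 < size B)%N ->
  (forall d, d != 0 -> (count (fun y => (d + y)%R \in A) A <=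
                        count (fun y => (d + y)%R \in B) B)%N) ->
  (size A <= size B)%N.
Proof.
move=> Au Bu B0 AB.
pose D := undup ([seq x - y | x <- A, y <- A] ++ [seq x - y | x <- B, y <- B]).
have Du : uniq D by exact: undup_uniq.
have AD : {in A &, forall x y, x - y \in D}.
  move=> x y xA yA; rewrite mem_undup mem_cat; apply/orP; left.
  by apply/allpairsP; exists (x, y).
have BD : {in B &, forall x y, x - y \in D}.
  move=> x y xB yB; rewrite mem_undup mem_cat; apply/orP; right.
  by apply/allpairsP; exists (x, y).
have D0 : 0 \in D.
  have [x xB] : exists x, x \in B.
    by case: (B) B0 => // x B' _; exists x; rewrite mem_head.
  by rewrite -(subrr x) BD.
have split0 (s : seq V) :
    (\sum_(d <- D) count (fun y => (d + y)%R \in s) s =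
     size s + \sum_(d <- D | d != 0%R) count (fun y => (d + y)%R \in s) s)%N.
  rewrite (bigD1_seq 0) //=; congr addn.
  by rewrite -[RHS]count_predT; apply: eq_in_count => y ys; rewrite add0r ys.
have := size_sqr_by_diff Au Du AD; have := size_sqr_by_diff Bu Du BD.
rewrite !split0 => sqB sqA.
have : (\sum_(d <- D | d != 0%R) count (fun y => (d + y)%R \in A) A <=
        \sum_(d <- D | d != 0%R) count (fun y => (d + y)%R \in B) B)%N.
  exact: leq_sum.
by move: sqA sqB; rewrite -!mulnn; nia.
Qed.

(** * Solutions in a box: the central right-hand side has the most *)

(** The sum of all [|w i 0|] bounds every coordinate, which gives a finite type to enumerate; the
    filter cuts down to the actual box. *)
Definition box_sols m n (M : 'M[int]_(m, n)) (w : 'cV[int]_n) (b : 'cV[int]_m) :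
    seq 'cV[int]_n :=
  let coords (t : {ffun 'I_n -> 'I_(\sum_i `|w i 0%R|)%N.+1}) : 'cV[int]_n :=
    \col_i (t i : nat)%:Z in
  [seq y : 'cV[int]_n <- undup (map coords (enum predT)) |
    [forall i, 0 <= y i 0 <= w i 0] && (M *m y == b)].

Lemma box_sols_uniq m n (M : 'M[int]_(m, n)) w b : uniq (box_sols M w b).
Proof. by rewrite filter_uniq ?undup_uniq. Qed.

Lemma mem_box_sols m n (M : 'M[int]_(m, n)) w b y :
  (y \in box_sols M w b) = [forall i, 0 <= y i 0 <= w i 0] && (M *m y == b).
Proof.
rewrite mem_filter andb_idr // => /andP[/forallP y_box _].
rewrite mem_undup; apply/mapP.
exists [ffun i => inord `|y i 0%R|%N]; first by rewrite mem_enum.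
apply/colP => i; rewrite mxE ffunE inordK; have := y_box i; first by case: (y i 0).
by rewrite ltnS (bigD1 i) //=; move: (y i 0) (w i 0); lia.
Qed.

Lemma box_solsP m n (M : 'M[int]_(m, n)) (w : 'cV_n) b (y : 'cV_n) :
  reflect ((forall i, 0 <= y i 0 <= w i 0) /\ M *m y = b) (y \in box_sols M w b).
Proof.
by rewrite mem_box_sols; apply: (iffP andP) => -[/forallP ? /eqP ?].
Qed.

Definition neg_part n (d : 'cV[int]_n) : 'cV[int]_n := \col_i Num.max (- d i 0) 0.

(* A pair [(d + y, y)] in a box is determined by its coordinatewise minimum
   [y - neg_part d], which ranges over the solutions in the box of side
   lengths [w - |d|], where [|d| = d + 2 (neg_part d)]. *)
Lemma count_box_sols_shift m n (M : 'M[int]_(m, n)) w b d : M *m d = 0 ->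
  count (fun y => d + y \in box_sols M w b) (box_sols M w b) =
  size (box_sols M (w - (d + neg_part d *+ 2)) (b - M *m neg_part d)).
Proof.
move=> Md; rewrite -size_filter -(size_map (fun y => y - neg_part d)).
apply/perm_size/uniq_perm.
- rewrite map_inj_uniq; last exact: addIr.
  by rewrite filter_uniq ?box_sols_uniq.
- exact: box_sols_uniq.
move=> r; apply/mapP/box_solsP => [[y]|[r_box Mr]].
  rewrite mem_filter => /andP[/box_solsP[dy_box _] /box_solsP[y_box My]] ->.
  split=> [i|]; last by rewrite mulmxBr My.
  by have := dy_box i; have := y_box i; rewrite !mxE; case: (leP (- d i 0) 0); lra.
exists (r + neg_part d); last by rewrite addrK.
rewrite mem_filter; apply/andP; split; apply/box_solsP; split.
- by move=> i; have := r_box i; rewrite !mxE; case: (leP (- d i 0) 0); lra.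
- by rewrite !mulmxDr Md Mr add0r subrK.
- by move=> i; have := r_box i; rewrite !mxE; case: (leP (- d i 0) 0); lra.
- by rewrite mulmxDr Mr subrK.
Qed.

Lemma box_sols_central_max m n (M : 'M[int]_(m, n)) (w : 'cV[int]_n)
    (b b' : 'cV[int]_m) : unimodular M ->
  (forall i, 0 <= w i 0) -> M *m w = b + b ->
  (size (box_sols M w b') <= size (box_sols M w b))%N.
Proof.
move=> uM; have [N] := ubnP (\sum_i `|w i 0%R|)%N.
elim: N w b b' => // N IH w b b' wN w0 Mw.
have [z z_box Mz] : exists2 z : 'cV[int]_n, forall j, 0 <= z j 0 <= w j 0 &
    M *m z = b.
  apply: (@unimodular_box_round _ _ _ _ _ (2^-1 *: map_mx intr w)) => // [j|].
    by have := w0 j; rewrite -(ler0z rat) !mxE => ?; apply/andP; split; lra.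
  rewrite -scalemxAr -map_mxM Mw map_mxD.
  by apply/matrixP => i j; rewrite !mxE; lra.
apply: leq_size_by_diff; rewrite ?box_sols_uniq //.
  have : z \in box_sols M w b by apply/box_solsP.
  by case: box_sols.
move=> d d0.
(* If no pair for [b'] has difference [d], the left count is 0. Otherwise such a pair gives
   [M *m d = 0] and [|d| <= w], as the induction requires. *)
have [/hasP[y /box_solsP[y_box My] /box_solsP[dy_box Mdy]]|] :=
  boolP (has (fun y => d + y \in box_sols M w b') (box_sols M w b')); last first.
  by rewrite has_count lt0n negbK => /eqP ->.
have Md : M *m d = 0.
  by move: Mdy; rewrite mulmxDr My => /(canRL (addrK _)); rewrite subrr.
rewrite !count_box_sols_shift //; apply: IH.
- have [i di0] : exists i, d i 0 != 0 by apply/cV0Pn.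
  move: wN; rewrite ltnS; apply: leq_trans.
  rewrite (bigD1 i) //= [X in (_ < X)%N](bigD1 i) //= -addSn.
  apply: leq_add; last apply: leq_sum => j _.
    move: di0; have := y_box i; have := dy_box i; rewrite !mxE.
    move: (d i 0) (w i 0) (y i 0) => di wi yi.
    by case: (leP (- di) 0) => ? /andP[? ?] /andP[? ?] /eqP ?; lia.
  have := y_box j; have := dy_box j; rewrite !mxE.
  move: (d j 0) (w j 0) (y j 0) => di wi yi.
  by case: (leP (- di) 0) => ? /andP[? ?] /andP[? ?]; lia.
- move=> i; have := y_box i; have := dy_box i; rewrite !mxE.
  by case: (leP (- d i 0) 0); lra.
(* As [d] is in the kernel, [M] maps [|d|] to twice the image of [neg_part d], so the new right-hand
   side is again central. *)
- by rewrite mulmxBr mulmxDr Md add0r mulr2n mulmxDr Mw opprD addrACA.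
Qed.

(** * Log-concavity for nonnegative integer solutions *)

(** An upper bound is wanted for [A] and [C] and a lower one for [B], hence one inclusion for
    each. *)
Lemma nonneg_sols_log_concave m n (M : 'M[int]_(m, n)) (b c : 'cV[int]_m)
    (A B C : seq 'cV[int]_n) : unimodular M -> uniq A -> uniq B -> uniq C ->
  {in A, forall y : 'cV_n, (forall i, 0 <= y i 0) /\ M *m y = b - c} ->
  {in C, forall y : 'cV_n, (forall i, 0 <= y i 0) /\ M *m y = b + c} ->
  (forall y : 'cV_n, (forall i, 0 <= y i 0) -> M *m y = b -> y \in B) ->
  (size A * size C <= size B ^ 2)%N.
Proof.
move=> uM Au Bu Cu AP CP BP.
pose D := undup ([seq x + y | x <- A, y <- C] ++ [seq x + y | x <- B, y <- B]).
have Du : uniq D by exact: undup_uniq.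
have AD : {in A & C, forall x y, x + y \in D}.
  move=> x y xA yC; rewrite mem_undup mem_cat; apply/orP; left.
  by apply/allpairsP; exists (x, y).
have BD : {in B &, forall x y, x + y \in D}.
  move=> x y xB yB; rewrite mem_undup mem_cat; apply/orP; right.
  by apply/allpairsP; exists (x, y).
rewrite -mulnn (size_mul_by_sum Au Du AD) (size_mul_by_sum Bu Du BD).
apply: leq_sum => w _.
have [/hasP[y /CP[y0 My] /AP[wy0 Mwy]]|] :=
  boolP (has (fun y => w - y \in A) C); last first.
  by rewrite has_count lt0n negbK => /eqP ->.
have w0 i : 0 <= w i 0 
  by apply: le_trans (y0 i) _; have := wy0 i; rewrite !mxE subr_ge0.
have Mw : M *m w = b + b.
  by rewrite -[w](subrK y) mulmxDr Mwy My addrACA addNr addr0.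
(* Pairs are recorded by their second entry, which is at most [w] because the first is
   nonnegative. *)
apply: (@leq_trans (size (box_sols M w (b + c)))).
  rewrite -size_filter; apply: uniq_leq_size; first by rewrite filter_uniq.
  move=> z; rewrite mem_filter => /andP[/AP[wz0 _] /CP[z0 Mz]].
  apply/box_solsP; split=> // i; rewrite z0 /=.
  by have := wz0 i; rewrite !mxE subr_ge0.
apply: (leq_trans (box_sols_central_max _ uM w0 Mw)).
(* Conversely, a central solution [z] yields the pair [(w - z, z)] in [B]. *)
rewrite -size_filter; apply: uniq_leq_size; first exact: box_sols_uniq.
move=> z /box_solsP[z_box Mz]; rewrite mem_filter; apply/andP; split.
  apply: BP => [i|]; first by have /andP[] := z_box i; rewrite !mxE subr_ge0.
  by rewrite mulmxBr Mw Mz addrK.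
by apply: BP => // i; have /andP[] := z_box i.
Qed.

(** * Lattice points of dilates and the Ehrhart polynomial *)

Lemma bounded_integer_points_finite (R : realType) n (A : set 'cV[R]_n) :
  bounded_set A -> finite_set (A `&` @integer_lattice R n).
Proof.
(* [bounded_set] bounds the norm by radii strictly above [C], hence [C + 1]. *)
case=> C [_ /(_ (C + 1))]; rewrite ltrDl ltr01 => /(_ isT) AC.
pose N := (Num.bound (C + 1)).
pose point (t : {ffun 'I_n -> 'I_(N.*2).+1}) : 'cV[R]_n :=
  \col_i (t i)%:R - const_mx N%:R.
apply: (@sub_finite_set _ _ [set` map point (enum predT)]); last exact: finite_seq.
move=> x [/AC xC xint]; apply/mapP.
have x_bound i : - N%:R <= x i 0 <= N%:R.
  rewrite -ler_norml (le_trans _ (ltW (archi_boundP _))) //; last first.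
    exact: le_trans xC.
  apply: le_trans xC; rewrite [leRHS]mx_normrE.
  exact: (le_bigmax _ (fun ij => `|x ij.1 ij.2|) (i, 0)).
exists [ffun i => inord `|(Num.floor (x i 0) + N%:Z)%R|%N]; first by rewrite mem_enum.
apply/colP => i; rewrite !mxE ffunE.
have := xint i; rewrite intrEfloor => /eqP xiE.
have := x_bound i; move: xiE; set z := Num.floor _ => <-.
rewrite -[N%:R]/(N%:Z%:~R) -mulrNz !ler_int => zN.
rewrite inordK; last by move: z zN; lia.
have zN0 : 0 <= z + N%:Z by move: z zN; lia.
by rewrite natr_absz ger0_norm // rmorphD /= addrK.
Qed.

Lemma bounded_set_dilate (R : realType) n (k : nat) (P : set 'cV[R]_n) :
  bounded_set P -> bounded_set (dilate k P).
Proof.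
case=> C [_ /(_ (C + 1))]; rewrite ltrDl ltr01 => /(_ isT) PC.
exists (k%:R * (C + 1)); split; first exact: num_real.
move=> D /ltW kD _ [x Px <-]; rewrite /= normrZ normr_nat.
by apply: le_trans kD; rewrite ler_wpM2l // PC.
Qed.

Lemma lattice_count_log_concave (R : realType) n (P : set 'cV[R]_n) (k : nat) :
  unimodular_polytope P ->
  (lattice_count (dilate k P) * lattice_count (dilate k.+2 P) <=
   lattice_count (dilate k.+1 P) ^ 2)%N.
Proof.
move=> [bndP [m [M [b [uM PE]]]]].
pose pts j := [seq map_mx Num.floor x |
  x <- finmap.enum_fset (fset_set (dilate j P `&` @integer_lattice R n))].
have fin j : finite_set (dilate j P `&` @integer_lattice R n).
  exact/bounded_integer_points_finite/bounded_set_dilate.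
have inE j x : x \in finmap.enum_fset (fset_set (dilate j P `&` @integer_lattice R n))
    -> dilate j P x /\ @integer_lattice R n x.
  by move=> xj; have := in_fset_set (fin j) x; rewrite [LHS]xj => /esym/set_mem.
have floorK x : @integer_lattice R n x -> map_mx intr (map_mx Num.floor x) = x.
  by move=> xZ; apply/colP => i; rewrite !mxE; apply/eqP; rewrite -intrEfloor.
have pts_uniq j : uniq (pts j).
  rewrite map_inj_in_uniq ?finmap.fset_uniq // => x y /inE[_ xZ] /inE[_ yZ] xy.
  by rewrite -(floorK x) // xy floorK.
have ptsP j (y : 'cV[int]_n) : y \in pts j ->
    (forall i, 0 <= y i 0) /\ M *m y = j%:Z *: b.
  move=> /mapP[x /inE[[p Pp px] xZ] yx].
  have {}px : map_mx intr y = j%:R *: p by rewrite yx floorK.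
  move: Pp; rewrite PE => -[p0 Mp]; split=> [i|].
    rewrite -(ler0z R); have /colP/(_ i) := px; rewrite mxE => ->.
    by rewrite mxE mulr_ge0.
  suff /matrixP E : map_mx intr (M *m y) = map_mx intr (j%:Z *: b) :> 'cV[R]_m.
    apply/matrixP => i l; have := E i l.
    by rewrite 2![map_mx _ _ _ _]mxE => /intr_inj.
  by rewrite map_mxM px -scalemxAr Mp map_mxZ.
have sizeE j : size (pts j) = lattice_count (dilate j P) by rewrite size_map.
rewrite -!sizeE.
apply: (@nonneg_sols_log_concave _ _ M (k.+1%:Z *: b) b) => //.
- move=> y /ptsP[y0 ->]; split=> //.
  by rewrite -[X in _ - X]scale1r -scalerBl intS addrAC subrr add0r.
- move=> y /ptsP[y0 ->]; split=> //.
  by rewrite -[X in _ + X]scale1r -scalerDl [in LHS]intS addrC.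
(* This inclusion divides by [k.+1], so it uses a positive factor; for factor 0 and empty [P] the
   solution 0 would be missed. *)
move=> y y0 My; apply/mapP; exists (map_mx intr y); last first.
  by apply/colP => i; rewrite !mxE intrKfloor.
have k0 : (k.+1%:R : R) != 0 by rewrite pnatr_eq0.
suff : map_mx intr y \in dilate k.+1 P `&` @integer_lattice R n.
  by rewrite -(in_fset_set (fin _)).
apply/mem_set; split; last by move=> i; rewrite mxE intr_int.
exists (k.+1%:R^-1 *: map_mx intr y); last by rewrite scalerA divff ?scale1r.
rewrite PE; split=> [i|].
  by rewrite !mxE mulr_ge0 ?invr_ge0 ?ler0z.
by rewrite -scalemxAr -map_mxM My map_mxZ scalerA mulVf ?scale1r.
Qed.

Theorem corollary1p5 (R : realType) (n : nat) (P : set 'cV[R]_n)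
    (hP : unimodular_polytope P) (k : nat) (hk : (1 <= k)%N) :
  (ehrhart_poly P).[k%:R] ^+ 2 >=
    (ehrhart_poly P).[k%:R - 1] * (ehrhart_poly P).[k%:R + 1].
Proof.
(* Without an Ehrhart polynomial, [ehrhart_poly P] would be the default 0, so
   its existence need not be proved. *)
have [[E hE]|nE] := pselect (exists E, is_ehrhart_poly P E); last first.
  have -> : ehrhart_poly P = 0.
    by apply: xgetPN => E hE; apply: nE; exists E.
  by rewrite !horner0 mul0r expr0n.
rewrite (ehrhart_polyE hE); case: k hk => // k _.
have -> : k.+1%:R - 1 = k%:R :> R by rewrite -natr1 addrK.
rewrite natr1 !hE -natrM -natrX ler_nat.
exact: lattice_count_log_concave.
Qed.
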